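(* For every integer $d\geq 2$, let $A_d(n)$ denote the number of $d$-dimensional polycubes with $n$ cells, counted up to translation, and let $\lambda_d=\lim_{n\to\infty}A_d(n+1)/A_d(n)$. Then $\lambda_d \leq (2d-2)e + \frac{1}{2d-2}$.
   Context: A $d$-dimensional polycube of size $n$ is a set of $n$ unit cubes (cells) of the cubical lattice $\mathbb{Z}^d$ that is connected via shared $(d-1)$-dimensional faces. Two polycubes are identified if one is a translate of the other (fixed polycubes). $A_d(n)$ is the number of such polycubes of size $n$. It is known that the limit $\lambda_d=\lim_{n\to\infty}A_d(n+1)/A_d(n)$ exists and equals $\lim_{n\to\infty}A_d(n)^{1/n}$. Here $e$ is Euler's number. *)

(* Defs.v *)
From HB Require Import structures.
From mathcomp Require Import all_boot all_order all_algebra finmap.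
From mathcomp Require Import all_classical all_reals all_analysis.

Set Implicit Arguments.
Unset Strict Implicit.
Unset Printing Implicit Defensive.

Import Order.TTheory GRing.Theory Num.Theory.

Local Open Scope classical_set_scope.
Local Open Scope ring_scope.

(* The cell with index [a] is the unit cube [a_0, a_0 + 1] x ... of the lattice. *)
Definition cell (d : nat) := 'rV[int]_d.

(* Two unit cubes share a (d-1)-dimensional face exactly when their indices
   differ by 1 in one coordinate and agree in all the others. *)
Definition share_face (d : nat) (a b : cell d) : bool :=
  [exists i : 'I_d, (`|a 0 i - b 0 i| == 1) &&
    [forall j : 'I_d, (j != i) ==> (a 0 j == b 0 j)]].

(* [P] is coerced to the finite type of its cells, so that the connecting
   paths stay inside [P]. *)
Definition face_connected (d : nat) (P : {fset cell d}) : Prop :=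
  forall a b : P, connect (fun x y : P => share_face (val x) (val y)) a b.

Definition polycubes (d n : nat) : set {fset cell d} :=
  [set P | #|` P| = n /\ face_connected P].

Arguments polycubes : clear implicits.

Definition translate (d : nat) (v : cell d) (P : {fset cell d}) :
  {fset cell d} := [fset (a + v)%R | a in P]%fset.

Definition translation_class (d : nat) (P : {fset cell d}) :
  set {fset cell d} := [set translate v P | v in [set: cell d]].

(* [fset_set] is the finite set underlying a finite [set]; the set of
   translation classes is finite since each class of a nonempty polycube
   contains a polycube through the origin, and a connected set of [n] cells
   through the origin lies in a ball of radius [n]. *)
Definition A (d n : nat) : nat :=
  #|` fset_set [set translation_class P | P in polycubes d n]|.

(* Main.v *)
Require Import Defs.
From HB Require Import structures.
From mathcomp Require Import all_boot all_order all_algebra finmap.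
From mathcomp Require Import all_classical all_reals all_analysis.
From mathcomp Require Import ring lra zify.

Import Order.TTheory GRing.Theory Num.Theory.
Import numFieldNormedType.Exports.

Local Open Scope classical_set_scope.
Local Open Scope ring_scope.

(** Explore a polycube [P] from a given cell, asking for one cell at a time
    whether it lies in [P] and, when it does, appending queries for its
    neighbours.  Suppose [q] was reached from [q - b], itself reached from
    [q - b - a] by a turn [a <> b].  Then [q - a] is a neighbour of the known
    cell [q - b - a], so its status is already settled or pending, and only
    [2d - 2] neighbours of [q] are asked; for a cell reached without a turn
    there are [2d - 1] of them.  Give the pending cells weight [t] when reached
    by a turn and [s = t (1 + t)] otherwise: the number of polycubes of size
    [n] compatible with the current answers is at most [g ^ (n - #known)] times
    the product of the factors [1 + weight] of the pending queries, provided
    [g t = (1 + s) (1 + t) ^ (2d - 3)] and [g s = (1 + s) (1 + t) ^ (2d - 2)],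
    and both equations define the same [g].  Hence [lambda <= g], and
    [1 + t = exp (1 / (2d - 2))] gives the bound. *)

(** * Unit steps of the lattice *)

Definition dir (d : nat) : finType := ('I_d * bool)%type.

Definition dvec {d : nat} (e : dir d) : cell d :=
  if e.2 then - delta_mx 0 e.1 else delta_mx 0 e.1.

Definition dopp {d : nat} (e : dir d) : dir d := (e.1, ~~ e.2).

Lemma dvec_opp {d : nat} (e : dir d) : dvec (dopp e) = - dvec e.
Proof. by case: e => i [] /=; rewrite /dvec //= opprK. Qed.

Lemma doppK {d : nat} (e : dir d) : dopp (dopp e) = e.
Proof. by case: e => i []. Qed.

Lemma dopp_neq {d : nat} (e : dir d) : e != dopp e.
Proof. by case: e => i []; rewrite /dopp xpair_eqE andbF. Qed.

Lemma share_face_dir {d : nat} (a b : cell d) :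
  share_face a b -> exists e : dir d, b = a + dvec e.
Proof.
move=> /existsP[i /andP[/eqP hi /forallP hj]].
exists (i, 0 < a 0 i - b 0 i); apply/rowP => j; rewrite /dvec /=.
have [->|ji] := eqVneq j i; last first.
  have /eqP abj := implyP (hj j) ji.
  by case: ifP; rewrite !mxE eqxx (negbTE ji) /= ?oppr0 addr0 abj.
by case: ifP hi; rewrite !mxE !eqxx /=; lia.
Qed.

Lemma share_face_sym {d : nat} (a b : cell d) : share_face a b = share_face b a.
Proof.
rewrite /share_face; apply: eq_existsb => i; rewrite distrC; congr (_ && _).
by apply: eq_forallb => j; rewrite (eq_sym (a 0 j)).
Qed.

(** * Connectedness through step-closed subsets *)

Definition step_closed {d : nat} (P I : {fset cell d}) : Prop :=
  forall c (e : dir d), c \in I -> c + dvec e \in P -> c + dvec e \in I.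

(** Connectedness in the form the exploration uses: once no query is pending, the known cells are
    step-closed in [P] and hence exhaust it. *)
Definition inseparable {d : nat} (P : {fset cell d}) : Prop :=
  forall I : {fset cell d}, (I `<=` P)%fset -> I != fset0 ->
  step_closed P I -> I = P.

Lemma face_connected_inseparable {d : nat} (P : {fset cell d}) :
  face_connected P -> inseparable P.
Proof.
move=> Pc I /fsubsetP sIP /fset0Pn[a aI] Icl; apply/fsetP => b.
apply/idP/idP => [/sIP //|bP].
have aP := sIP _ aI.
have /closed_connect H : fingraph.closed (fun x y : P => share_face (val x) (val y))
    [pred x : P | val x \in I].
  move=> x y /= xy; rewrite !inE.
  have step (u v : P) : share_face (val u) (val v) -> val u \in I -> val v \in I.
    move=> /share_face_dir[e ve] uI; rewrite ve; apply: Icl => //.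
    by rewrite -ve; exact: valP.
  by apply/idP/idP; apply: step => //; rewrite share_face_sym.
by have := H _ _ (Pc [` aP]%fset [` bP]%fset); rewrite !inE /= aI => <-.
Qed.

(** * Translations *)

Lemma in_translate {d : nat} (v c : cell d) (P : {fset cell d}) :
  (c \in translate v P) = (c - v \in P).
Proof.
apply/imfsetP/idP => [[a aP ->]|cP]; first by rewrite addrK.
by exists (c - v) => //; rewrite subrK.
Qed.

Lemma translateD {d : nat} (v w : cell d) (P : {fset cell d}) :
  translate w (translate v P) = translate (v + w) P.
Proof. by apply/fsetP => c; rewrite !in_translate opprD addrA addrAC. Qed.

Lemma translate0 {d : nat} (P : {fset cell d}) : translate 0 P = P.
Proof. by apply/fsetP => c; rewrite in_translate subr0. Qed.

Lemma card_translate {d : nat} (v : cell d) (P : {fset cell d}) :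
  #|` translate v P| = #|` P|.
Proof. by rewrite card_imfset //; exact: addIr. Qed.

Lemma translation_class_translate {d : nat} (v : cell d) (P : {fset cell d}) :
  translation_class (translate v P) = translation_class P.
Proof.
apply/seteqP; split=> Q [w _ <-].
  by exists (v + w); rewrite ?translateD.
by exists (w - v) => //; rewrite translateD addrC subrK.
Qed.

Lemma inseparable_translate {d : nat} (v : cell d) (P : {fset cell d}) :
  inseparable P -> inseparable (translate v P).
Proof.
move=> Pc I /fsubsetP sI /fset0Pn[a aI] Icl.
suff H : translate (- v) I = P by rewrite -H translateD addNr translate0.
apply: Pc.
- apply/fsubsetP => c; rewrite in_translate opprK => /sI.
  by rewrite in_translate addrK.
- by apply/fset0Pn; exists (a - v); rewrite in_translate opprK subrK.
move=> c e; rewrite !in_translate !opprK => cI ceP.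
by rewrite addrAC; apply: Icl => //; rewrite in_translate addrAC addrK.
Qed.

(** * Queries of the exploration *)

(* [(q, b, o)] asks for the cell [q], reached from [q - b]; [o = Some a] records
   that [q - b] was itself reached in a direction [a] not parallel to [b]. *)
Definition query (d : nat) : Type := (cell d * dir d * option (dir d))%type.

Definition asked {d : nat} (u : query d) : cell d := u.1.1.

Definition valid_query {d : nat} (I : {fset cell d}) (u : query d) : bool :=
  let: (q, b, o) := u in
  (q - dvec b \in I) &&
  (if o is Some a then
     [&& q - dvec b - dvec a \in I, a != b & a != dopp b] else true).

Definition next_dirs {d : nat} (b : dir d) (o : option (dir d)) : pred (dir d) :=
  fun e => (e != dopp b) && (if o is Some a then e != dopp a else true).

Definition next_query {d : nat} (q : cell d) (b e : dir d) : query d :=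
  (q + dvec e, e, if e == b then None else Some b).

Definition next_queries {d : nat} (u : query d) : seq (query d) :=
  let: (q, b, o) := u in
  [seq next_query q b e | e <- enum (next_dirs b o)].

Lemma valid_queryS {d : nat} {I J : {fset cell d}} (u : query d) :
  (I `<=` J)%fset -> valid_query I u -> valid_query J u.
Proof.
move=> /fsubsetP IJ; case: u => -[q b] [a|] /andP[h1 h2] /=.
  by move: h2 => /and3P[h2 h3 h4]; rewrite !IJ //= h3.
by rewrite IJ.
Qed.

Lemma valid_next_queries {d : nat} (I : {fset cell d}) (u : query d) :
  valid_query I u -> all (valid_query (asked u |` I)%fset) (next_queries u).
Proof.
case: u => -[q b] o /andP[qbI _]; apply/allP => v /mapP[e].
rewrite mem_enum => /andP[eb _] ->; rewrite /next_query /valid_query /asked /=.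
rewrite addrK fset1U1 /=; case: eqVneq => //= nb.
rewrite in_fset1U qbI orbT eq_sym nb /=.
by apply: contra eb => /eqP ->; rewrite doppK.
Qed.

(** * Weights and the balance equation *)

Definition weight {R : realType} {d : nat} (t : R) (u : query d) : R :=
  if u.2 is Some _ then t else t * (1 + t).

Definition growth {R : realType} (d : nat) (t : R) : R :=
  (1 + t * (1 + t)) * (1 + t) ^+ (2 * d - 3) / t.

Lemma growth_gt0 {R : realType} (d : nat) (t : R) : 0 < t -> 0 < growth d t.
Proof.
by move=> t0; rewrite /growth !(mulr_gt0, exprn_gt0, invr_gt0) //; nra.
Qed.

Lemma weight_ge0 {R : realType} {d : nat} (t : R) (u : query d) :
  0 < t -> 0 <= weight t u.
Proof. by move=> t0; rewrite /weight; case: u.2 => // *; nra. Qed.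

Lemma prod_weight_ge0 {R : realType} {d : nat} (t : R) (Q : seq (query d)) :
  0 < t -> 0 <= \prod_(v <- Q) (1 + weight t v).
Proof.
by move=> t0; apply: prodr_ge0 => v _; have := weight_ge0 t v t0; lra.
Qed.

(** Going straight on along [b] gives one factor [1 + t * (1 + t)]; every other direction is a turn
    and gives [1 + t]. There are [2 * d - 3] turns if [q] was reached by a turn and one more
    otherwise, and this extra factor [1 + t] is the ratio of the two weights. *)
Lemma next_queries_weight {R : realType} {d : nat} (t : R) (I : {fset cell d})
  (u : query d) : 0 < t -> (2 <= d)%N -> valid_query I u ->
  \prod_(v <- next_queries u) (1 + weight t v) = growth d t * weight t u.
Proof.
move=> t0 d2; case: u => -[q b] o /andP[_ ho].
rewrite /next_queries big_map big_enum /=.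
have bb : b != dopp b by exact: dopp_neq.
have bN : next_dirs b o b.
  rewrite /next_dirs bb /=; case: o ho => //= a /and3P[_ _ ab].
  by apply: contra ab => /eqP ->; rewrite doppK.
rewrite (bigD1 b bN) /=.
rewrite {1}/weight /= eqxx.
rewrite (eq_bigr (fun=> 1 + t)); last first.
  by move=> e /andP[_ /negbTE nb]; rewrite /weight /= nb.
rewrite prodr_const.
have cD : #|{: dir d}| = (2 * d)%N by rewrite card_prod card_ord card_bool mulnC.
have key : (#|[pred e | next_dirs b o e && (e != b)]|
    = if o is Some _ then 2 * d - 3 else (2 * d - 3).+1)%N.
  case: o ho bN => [a /and3P[_ nab nab']|_] _.
    rewrite (_ : #|_| = #|~: [set b; dopp b; dopp a]|).
      rewrite cardsCs finset.setCK cD -finset.setUA cardsU1 cards2 !inE.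
      rewrite (negbTE bb) /=.
      have -> : (b == dopp a) = false.
        by apply/negP => /eqP ba; rewrite ba doppK eqxx in nab'.
      have -> : (dopp b == dopp a) = false.
        apply/negP => /eqP/(congr1 dopp); rewrite !doppK => ba.
        by rewrite ba eqxx in nab.
      by rewrite /=; lia.
    apply: eq_card => e; rewrite !inE /next_dirs !negb_or.
    by case: (e == b); case: (e == dopp b); case: (e == dopp a).
  rewrite (_ : #|_| = #|~: [set b; dopp b]|).
    by rewrite cardsCs finset.setCK cD cards2 bb /=; lia.
  by apply: eq_card => e; rewrite !inE /next_dirs !negb_or andbT andbC.
rewrite (eq_card (B := [pred e | next_dirs b o e && (e != b)])) // key.
have tn : t != 0 by rewrite gt_eqF.
rewrite /growth /weight /=; case: o {ho bN key} => [a|]; rewrite ?exprS; by field.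
Qed.

(** * Counting the polycubes compatible with the answers *)

Definition compatible {d : nat} (n : nat) (I : {fset cell d}) (Q : seq (query d))
  (P : {fset cell d}) : Prop :=
  [/\ (I `<=` P)%fset, #|` P| = n, inseparable P &
    forall c (e : dir d), c \in I -> c + dvec e \in P ->
      (c + dvec e \in I) || (c + dvec e \in map asked Q)].

Lemma compatible_nil {d n : nat} {I P : {fset cell d}} :
  I != fset0 -> compatible n I [::] P -> P = I.
Proof.
move=> I0 [sIP _ Pc Icl]; apply/esym/Pc => // c e cI ceP.
by have := Icl c e cI ceP; rewrite in_nil orbF.
Qed.

Lemma compatible_drop {d n : nat} {I P : {fset cell d}} {u Q} :
  (asked u \in P -> asked u \in I) ->
  compatible n I (u :: Q) P -> compatible n I Q P.
Proof.
move=> uI [sIP Pn Pc Icl]; split=> // c e cI ceP.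
have := Icl c e cI ceP; rewrite in_cons => /or3P[->//|/eqP E|->]; last exact: orbT.
by rewrite E uI // -E.
Qed.

(* A turned query at [q] omits the neighbour [q - a]: it is a neighbour of the
   cell [q - b - a] of [I], so it already is in [I] or in [Q]. *)
Lemma compatible_add {d n : nat} {I P : {fset cell d}} {u Q} :
  valid_query I u -> asked u \in P -> compatible n I (u :: Q) P ->
  compatible n (asked u |` I)%fset (Q ++ next_queries u) P.
Proof.
move=> uv uP [sIP Pn Pc Icl]; split=> //.
  by rewrite fsubUset fsub1set uP.
have old c e : c \in I -> c + dvec e \in P ->
    (c + dvec e \in (asked u |` I)%fset) ||
    (c + dvec e \in map asked (Q ++ next_queries u)).
  move=> cI /(Icl c e cI); rewrite in_cons map_cat mem_cat in_fset1U.
  by move=> /or3P[] ->; rewrite ?orbT.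
move=> c e; rewrite in_fset1U => /orP[/eqP -> {c} ceP|]; last exact: old.
case: u uv uP Icl old ceP => -[q b] o /andP[qbI ho] uP Icl old.
rewrite /asked /= => ceP.
have [eb|eb] := eqVneq e (dopp b).
  by rewrite in_fset1U eb dvec_opp qbI orbT.
have [eN|] := boolP (next_dirs b o e).
  apply/orP; right; rewrite map_cat mem_cat; apply/orP; right.
  apply/mapP; exists (next_query q b e) => //.
  by apply: map_f; rewrite mem_enum.
rewrite /next_dirs eb /=; case: o ho uP Icl old => [a /and3P[abI _ _] _ _ old|//].
rewrite negbK => /eqP ea.
have := old _ b abI.
rewrite (_ : q - dvec b - dvec a + dvec b = q + dvec e); first exact.
by rewrite ea dvec_opp addrAC subrK.
Qed.

(** Induction on the number [k] of cells still to be found, then on the pending queries. The head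
    query splits [L]: a negative answer removes the query, a positive one lowers [k] and trades the
    factor [growth d t] for the new queries. *)
Lemma size_compatible {R : realType} {d : nat} (t : R) (n k : nat)
  (I : {fset cell d}) (Q : seq (query d)) (L : seq {fset cell d}) :
  0 < t -> (2 <= d)%N -> I != fset0 -> (#|` I| + k)%N = n ->
  all (valid_query I) Q -> uniq L -> (forall P, P \in L -> compatible n I Q P) ->
  (size L)%:R <= growth d t ^+ k * \prod_(v <- Q) (1 + weight t v).
Proof.
move=> t0 d2; have g0 := ltW (growth_gt0 d t t0).
elim: k I Q L => [|k IHk] I Q L.
  (* All [n] cells are known, so [I] is the only candidate. *)
  move=> I0; rewrite addn0 => In _ uL LP.
  have {}LP : {subset L <= [:: I]}.
    move=> P /LP[sIP Pn _ _]; rewrite inE eq_sym.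
    by rewrite eqEfcard sIP Pn In /=.
  have s1 : (size L <= 1)%N by exact: (uniq_leq_size uL LP).
  rewrite expr0 mul1r; apply: (@le_trans _ _ 1); first by rewrite lern1.
  elim: Q => [|u Q IHQ]; first by rewrite big_nil.
  by rewrite big_cons; have := weight_ge0 t u t0; nra.
elim: Q L => [|u Q IHQ] L I0 In Qv uL LP.
  rewrite big_nil mulr1.
  (* Without pending queries [P] equals [I], which is too small. *)
  case: L uL LP => [|P L] uL LP; first by rewrite exprn_ge0.
  have PE : P = I by apply: (compatible_nil I0 (LP _ _)); rewrite mem_head.
  have := LP P (mem_head _ _); rewrite PE => -[_ E _ _].
  by exfalso; move: E In => ->; lia.
have [uv Qv'] := andP Qv.
have w0 := weight_ge0 t u t0.
have p0 := prod_weight_ge0 t Q t0.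
have [uI|uI] := boolP (asked u \in I).
  apply: (@le_trans _ _ (growth d t ^+ k.+1 * \prod_(v <- Q) (1 + weight t v))).
    by apply: IHQ => // P /LP; exact: compatible_drop.
  by rewrite ler_wpM2l ?exprn_ge0// big_cons; nra.
rewrite -(count_predC (fun P : {fset cell d} => asked u \in P)) -!size_filter.
rewrite natrD big_cons mulrDl mul1r mulrDr addrC; apply: lerD.
  apply: IHQ => //; first exact: filter_uniq.
  move=> P; rewrite mem_filter => /andP[/negP uP /LP].
  exact: compatible_drop.
apply: (@le_trans _ _ (growth d t ^+ k *
    \prod_(v <- Q ++ next_queries u) (1 + weight t v))).
  apply: (IHk (asked u |` I)%fset).
  - by apply/fset0Pn; exists (asked u); rewrite fset1U1.
  - by rewrite cardfsU1 uI; lia.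
  - rewrite all_cat valid_next_queries // andbT.
    by apply: sub_all Qv' => v; apply: valid_queryS; exact: fsubsetU1.
  - exact: filter_uniq.
  - by move=> P; rewrite mem_filter => /andP[uP /LP]; exact: compatible_add.
rewrite big_cat /= (next_queries_weight t I) // exprSr.
by rewrite le_eqVlt; apply/orP; left; apply/eqP; ring.
Qed.

(** * The exponential bound on the number of polycubes *)

Lemma compatible_origin {d n : nat} (P : {fset cell d}) :
  0 \in P -> #|` P| = n -> inseparable P ->
  compatible n [fset 0]%fset [seq (dvec e, e, None) | e : dir d] P.
Proof.
move=> P0 Pn Pc; split=> //; first by rewrite fsub1set.
move=> c e; rewrite in_fset1 => /eqP -> _; apply/orP; right.
by rewrite add0r; apply/mapP; exists (dvec e, e, None) => //; exact: map_f (mem_enum _ _).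
Qed.

Lemma polycube_at_origin {d n : nat} {X : set {fset cell d}} :
  [set translation_class P | P in polycubes d n.+1] X ->
  exists P, translation_class P = X /\ [/\ 0 \in P, #|` P| = n.+1 & inseparable P].
Proof.
move=> [P [Pn /face_connected_inseparable Pc] <-].
have /fset0Pn[a aP] : P != fset0 by rewrite -cardfs_gt0 Pn.
exists (translate (- a) P); split; first exact: translation_class_translate.
split; first by rewrite in_translate sub0r opprK.
  by rewrite card_translate.
exact: inseparable_translate.
Qed.

Lemma A_le_growth {R : realType} (d n : nat) (t : R) : 0 < t -> (2 <= d)%N ->
  (A d n.+1)%:R <= growth d t ^+ n * (1 + t * (1 + t)) ^+ (2 * d).
Proof.
move=> t0 d2; rewrite /A; set S := (X in fset_set X).
(* [fset_set] is empty by default on an infinite set, so the inclusion holds in both cases. *)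
have subS X : X \in fset_set S -> S X.
  rewrite /fset_set; case: pselect => [fS|//]; case: cid => F SF /= XF.
  by rewrite SF.
have /choice[rep repP] (X : set {fset cell d}) : exists P, X \in fset_set S ->
    translation_class P = X /\ [/\ 0 \in P, #|` P| = n.+1 & inseparable P].
  have [XS|_] := boolP (X \in fset_set S); last by exists fset0.
  by have [P PX] := polycube_at_origin (subS X XS); exists P.
rewrite -(size_map rep); set L := map rep _.
have := @size_compatible R d t n.+1 n [fset 0]%fset
  [seq (dvec e, e, None) | e : dir d] L t0 d2.
rewrite big_map big_enum /= (eq_bigr (fun=> 1 + t * (1 + t))) //.
rewrite prodr_const card_prod card_ord card_bool mulnC; apply.
- by apply/fset0Pn; exists 0; rewrite fset11.
- by rewrite cardfs1 add1n.
- by apply/allP => u /mapP[e _ ->]; rewrite /= subrr fset11.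
- rewrite map_inj_in_uniq ?fset_uniq // => X Y /repP[XE _] /repP[YE _] XY.
  by rewrite -XE -YE XY.
- by move=> P /mapP[X /repP[_ [P0 Pn Pc]] ->]; exact: compatible_origin.
Qed.

(** * From the exponential bound to the limit of ratios *)

(** If [lambda] exceeded [g], the sequence would eventually grow at least like the powers of some
    [mu > g], which outrun [g ^+ n * C]. *)
Lemma ratio_limit_le {R : realType} (u : nat -> nat) (lambda g C : R) :
  0 < g -> (forall n, (u n.+1)%:R <= g ^+ n * C) ->
  (fun n : nat => (u n.+1)%:R / (u n)%:R : R) @ \oo --> lambda -> lambda <= g.
Proof.
move=> g0 uC cvu; rewrite leNgt; apply/negP => glambda.
pose mu := (g + lambda) / 2.
have gmu : g < mu by rewrite /mu; lra.
have : \forall n \near \oo, mu < (u n.+1)%:R / (u n)%:R.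
  by apply: (cvgr_gt lambda) => //; rewrite /mu; lra.
move=> [N _ HN].
have uN n : (N <= n)%N -> (0 < u n)%N /\ mu * (u n)%:R <= (u n.+1)%:R.
  move=> /HN /= h; have u0 : (0 < u n)%N.
    (* Division by zero gives 0, which is not above [mu]. *)
    rewrite lt0n; apply/eqP => E; move: h; rewrite E invr0 mulr0; lra.
  by split=> //; rewrite -ler_pdivlMr ?ltr0n //; exact: ltW.
have low k : mu ^+ k <= (u (N + k).+1)%:R.
  elim: k => [|k IHk].
    by rewrite expr0 ler1n addn0; have [] := uN N.+1 (leqnSn N).
  have [_] := uN (N + k).+1 ltac:(lia); rewrite addnS; apply: le_trans.
  by rewrite exprS ler_wpM2l //; lra.
have bnd k : (mu / g) ^+ k <= g ^+ N * C.
  rewrite expr_div_n ler_pdivrMr ?exprn_gt0 // (le_trans (low k)) //.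
  by rewrite (le_trans (uC _)) // exprD mulrAC.
have z1 : 0 < mu / g - 1 by rewrite subr_gt0 ltr_pdivlMr // mul1r.
(* Bernoulli's inequality makes the powers of [mu / g] unbounded. *)
have bern k : 1 + k%:R * (mu / g - 1) <= (mu / g) ^+ k.
  elim: k => [|k IHk]; first by rewrite expr0 mul0r addr0.
  rewrite exprS -[k.+1%:R]natr1; have k0 : 0 <= k%:R :> R by [].
  apply: (@le_trans _ _ (mu / g * (1 + k%:R * (mu / g - 1)))).
    by have := mulr_ge0 k0 (sqr_ge0 (mu / g - 1)); lra.
  by rewrite ler_wpM2l //; lra.
pose k := Num.truncn (g ^+ N * C / (mu / g - 1)).
have kP : g ^+ N * C / (mu / g - 1) < k.+1%:R by exact: truncnS_gt.
have := le_trans (bern k.+1) (bnd k.+1).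
by move: kP; rewrite ltr_pdivrMr //; lra.
Qed.

(** * Numerical estimate of the growth rate *)

Lemma expR1_le4 {R : realType} : expR 1 <= 4 :> R.
Proof.
have h : 1 / 2 <= expR (- (1 / 2)) :> R.
  by have := expR_ge1Dx (- (1 / 2) : R); lra.
have E : expR (- (1 / 2)) ^+ 2 * expR 1 = 1 :> R.
  by rewrite -expRM_natl -expRD (_ : _ + 1 = 0) ?expR0 //; field.
have : 1 / 4 <= expR (- (1 / 2)) ^+ 2 :> R by nra.
by have := expR_gt0 (1 : R); nra.
Qed.

(** The right side is the fourth power of [expR (z / 4)], and 3/8 is the quadratic coefficient of
    [(1 + z / 4) ^+ 4]. *)
Lemma expR_ge_quadratic {R : realType} (z : R) :
  0 <= z -> 1 + z + 3 / 8 * z ^+ 2 <= expR z.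
Proof.
move=> z0; have -> : expR z = expR (z / 4) ^+ 4.
  by rewrite -expRM_natl; congr expR; lra.
apply: (@le_trans _ _ ((1 + z / 4) ^+ 4)).
  have : 0 <= z ^+ 3 by exact: exprn_ge0.
  have : 0 <= z ^+ 4 by exact: exprn_ge0.
  lra.
by rewrite lerXn2r ?nnegrE ?expR_ge0 ?expR_ge1Dx //; lra.
Qed.

Lemma growth_expR {R : realType} (d : nat) : (2 <= d)%N ->
  let E : R := expR (2 * d%:R - 2)^-1 in
  growth d (E - 1) = expR 1 * (1 + (E * (E - 1))^-1).
Proof.
move=> d2 E; have m0 : 0 < 2 * d%:R - 2 :> R.
  by have : 2 <= d%:R :> R; [rewrite ler_nat | lra].
have E1 : 1 < E by rewrite expR_gt1 invr_gt0.
have -> : expR 1 = E ^+ (2 * d - 3) * E.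
  rewrite -exprSr -expRM_natl; congr expR.
  rewrite (_ : (2 * d - 3).+1 = (2 * d - 2)%N); last by lia.
  by rewrite natrB ?natrM ?mulfV ?gt_eqF //; lia.
rewrite /growth (addrC 1 (E - 1)) subrK; field.
by apply/andP; split; lra.
Qed.

Lemma growth_expR_le {R : realType} (d : nat) : (2 <= d)%N ->
  growth d (expR (2 * d%:R - 2)^-1 - 1) <=
  (2 * d%:R - 2) * expR 1 + 1 / (2 * d%:R - 2) :> R.
Proof.
move=> d2; rewrite growth_expR //.
have m2 : 2 <= 2 * d%:R - 2 :> R.
  by have : 2 <= d%:R :> R; [rewrite ler_nat | lra].
set m := 2 * d%:R - 2 in m2 *; pose z := m^-1.
have z0 : 0 < z by rewrite invr_gt0; lra.
have z2 : z <= 1 / 2 by rewrite div1r lef_pV2 ?posrE //; lra.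
have Eq := expR_ge_quadratic z (ltW z0).
have e0 := expR_gt0 (1 : R).
have e4 := @expR1_le4 R.
rewrite -/z div1r -/z -[m]invrK -/z.
move: (expR z) Eq => E Eq; move: (expR 1) e0 e4 => e e0 e4.
(* [z * D] is the product of the quadratic lower bounds for [E] and [E - 1], without its [z ^+ 4]
   term. *)
pose D := 1 + 11 / 8 * z + 3 / 4 * z ^+ 2.
have D0 : 0 < D by rewrite /D; nra.
have zDK : z * D <= E * (E - 1).
  apply: (@le_trans _ _ ((1 + z + 3 / 8 * z ^+ 2) * (z + 3 / 8 * z ^+ 2))).
    have : 0 <= z ^+ 3 by rewrite exprn_ge0 // ltW.
    have : 0 <= z ^+ 4 by rewrite exprn_ge0 // ltW.
    by rewrite /D; lra.
  by apply: ler_pM; nra.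
have K : (E * (E - 1))^-1 <= (z * D)^-1.
  by rewrite lef_pV2 ?posrE ?(lt_le_trans _ zDK) ?mulr_gt0.
apply: (@le_trans _ _ (e * (1 + (z * D)^-1))); first by rewrite ler_pM2l // lerD2l.
rewrite -subr_ge0.
pose N := - (3 / 8) + 5 / 8 * z + 3 / 4 * z ^+ 2.
have -> : z^-1 * e + z - e * (1 + (z * D)^-1) = (z * D - e * N) / D.
  by move: D0; rewrite /D /N => D0; field; rewrite !gt_eqF //; nra.
rewrite divr_ge0 ?(ltW D0) // subr_ge0.
(* Only a positive [N] needs a bound on [e]; 4 is enough since [z <= 1 / 2]. *)
have [N0|N0] := lerP N 0; first by nra.
apply: (@le_trans _ _ (4 * N)); first by rewrite ler_pM2r.
rewrite /N /D; nra.
Qed.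

Theorem theorem4 (R : realType) (d : nat) (hd : (2 <= d)%N) (lambda : R)
  (hlambda : (fun n : nat => (A d n.+1)%:R / (A d n)%:R : R) @ \oo --> lambda) :
  lambda <= (2 * d%:R - 2) * expR 1 + 1 / (2 * d%:R - 2).
Proof.
pose t : R := expR (2 * d%:R - 2)^-1 - 1.
have t0 : 0 < t.
  rewrite subr_gt0 expR_gt1 invr_gt0.
  by have : 2 <= d%:R :> R; [rewrite ler_nat | lra].
apply: le_trans (growth_expR_le d hd).
apply: ratio_limit_le hlambda; first exact: growth_gt0.
by move=> n; exact: A_le_growth.
Qed.
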